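(* Let $\alpha$ be a peak composition with at most one part greater than $2$. Then $$\widetilde{\mathcal S}_\alpha=\begin{cases}\widetilde{Q}_\alpha & \text{if }\alpha=(2,2,\dots,2,k)\text{ or }\alpha=(2,2,\dots,2,k,1)\text{ for }k\ge2,\\ \widetilde{Q}_\alpha-\widetilde{Q}_{s_i\cdot\alpha} & \text{otherwise.}\end{cases}$$ Here, $i$ denotes the index such that $\alpha_i=k$, where in the second case $k$ is the part of $\alpha$ greater than $2$, and $s_i\cdot\alpha$ is obtained from $\alpha$ by swapping its $i$th and $(i+1)$st parts. (The number of initial $2$'s in the displayed forms may be zero.)
   Context: Let $n$ be a nonnegative integer. A composition $\alpha=(\alpha_1,\dots,\alpha_k)$ of $n$ is a finite list of positive integers with sum $n$; $\ell(\alpha)=k$ (the empty composition is the unique composition of $0$). The diagram $D(\alpha)$ is the left-justified array with $\alpha_i$ boxes in row $i$, rows numbered from bottom to top; box $(i,j)$ lies in column $i$ and row $j$, and $T_{i,j}$ is the entry of $T$ there. A peak composition is a composition all of whose parts, except possibly the last, are greater than $1$. A filling of $D(\alpha)$ with $1,\dots,n$ satisfies the peak-tableau condition if for every $1\le k\le n$ the boxes with entries $\le k$ form the diagram of a peak composition. SPIT: for a peak composition $\alpha$, $\mathrm{SPIT}(\alpha)$ is the set of fillings of $D(\alpha)$ with $1,\dots,n$ (each once), rows increasing from left to right, first column increasing from bottom to top, satisfying the peak-tableau condition. SYCT: a standard Young composition tableau of shape $\alpha$ is a filling of $D(\alpha)$ with $1,\dots,n$ (each once), rows increasing from left to right, first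 column increasing from bottom to top, such that whenever $i<j$, $(k,j),(k+1,i)\in D(\alpha)$ and $T_{k,j}\le T_{k+1,i}$, then $(k+1,j)\in D(\alpha)$ and $T_{k+1,j}<T_{k+1,i}$. SPYCT: for a peak composition $\alpha$, $\mathrm{SPYCT}(\alpha)$ is the set of SYCTs of shape $\alpha$ satisfying the peak-tableau condition. Readings: $\mathrm{w}_{\rm c}(T)$ reads column by column starting from the leftmost column, each from bottom to top. $\mathrm{w}_{\rm Y}(T)$ reads the first column from top to bottom, then the subsequent columns from left to right, each from bottom to top. $\mathrm{Des}(\sigma)=\{i\in[n-1]\mid i$ is to the right of $i+1$ in $\sigma\}$; $\mathrm{Peak}(X)=\{i\in X\mid i>1,\ i-1\notin X\}$. For a composition $\gamma$ of $n$, $\mathrm{set}(\gamma)=\{\gamma_1,\gamma_1+\gamma_2,\dots,\gamma_1+\cdots+\gamma_{\ell(\gamma)-1}\}$; for $I=\{i_1<\cdots<i_p\}\subseteq[n-1]$, $\mathrm{comp}(I)=(i_1,i_2-i_1,\dots,n-i_p)$. $F_\gamma=\sum x_{i_1}\cdots x_{i_n}$ over $1\le i_1\le\cdots\le i_n$ with $i_j<i_{j+1}$ if $j\in\mathrm{set}(\gamma)$. For a peak composition $\gamma$ of $n$ with $I=\mathrm{set}(\gamma)$, $K_\gamma=2^{|I|+1}\sum F_\beta$ over compositions $\beta$ of $n$ with $I\subseteq\mathrm{set}(\beta)\triangle(\mathrm{set}(\beta)+1)$ ($\triangle$ symmetric difference, $\mathrm{set}(\beta)+1=\{i+1\mid i\in\mathrm{set}(\beta)\}$).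 Quasisymmetric Schur $Q$-function: $\widetilde{Q}_\alpha=\sum_{T\in\mathrm{SPIT}(\alpha)}K_{\mathrm{comp}(\mathrm{Peak}(\mathrm{Des}(\mathrm{w}_{\rm c}(T))))}$. Peak Young quasisymmetric Schur function: $\widetilde{\mathcal S}_\alpha=\sum_{T\in\mathrm{SPYCT}(\alpha)}K_{\mathrm{comp}(\mathrm{Peak}(\mathrm{Des}(\mathrm{w}_{\rm Y}(T))))}$. *)

(* Defs.v *)
From mathcomp Require Import all_boot all_order all_algebra finmap multiset.

Set Implicit Arguments.
Unset Strict Implicit.
Unset Printing Implicit Defensive.

Import GRing.Theory.
Local Open Scope nat_scope.

(* Conventions: the parts of a composition, and the rows and columns of a
   diagram, are indexed from 0 (row 0 is the bottom row, column 0 the leftmost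
   column); the entries of a filling, the values of words and the elements of
   the subsets of [n-1] are numbered from 1. Subsets of [n-1] are strictly
   increasing sequences. *)

Definition composition (n : nat) (gamma : seq nat) : bool :=
  all (leq 1) gamma && (sumn gamma == n).

Definition peak_composition (gamma : seq nat) : bool :=
  all (leq 1) gamma && all (ltn 1) (take (size gamma).-1 gamma).

(* The compositions of n.+1 with first part 1, then those with first part
   larger than 1; see mem_compositions and compositions_uniq. *)
Fixpoint compositions (n : nat) : seq (seq nat) :=
  if n is n'.+1 then
    [seq 1 :: c | c <- compositions n'] ++
    [seq (head 0 c).+1 :: behead c | c <- compositions n' & c != [::]]
  else [:: [::]].

Lemma mem_compositions n gamma : (gamma \in compositions n) = composition n gamma.
Proof.
rewrite /composition; elim: n gamma => [|n IHn] gamma.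
  by case: gamma => [|[|p] c] //=; rewrite addSn andbF.
rewrite /= mem_cat; apply/idP/idP.
  case/orP => /mapP[d].
    by rewrite IHn => /andP[d_pos /eqP <-] ->; rewrite /= d_pos add1n eqxx.
  rewrite mem_filter IHn => /andP[]; case: d => [|q d] //= _.
  by case/andP => /andP[_ d_pos] /eqP <- ->; rewrite /= d_pos addSn eqxx.
case: gamma => [|[|[|p]] c] //= /andP[c_pos]; rewrite addSn eqSS => sum_c.
  by apply/orP; left; apply/mapP; exists c; rewrite // IHn c_pos.
apply/orP; right; apply/mapP; exists (p.+1 :: c) => //.
by rewrite mem_filter IHn /= c_pos.
Qed.

Lemma compositions_uniq n : uniq (compositions n).
Proof.
elim: n => [|n IHn] //=; rewrite cat_uniq; apply/and3P; split.
- by rewrite map_inj_uniq // => c d [].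
- apply/hasPn => gamma /mapP[d]; rewrite mem_filter mem_compositions.
  case: d => [|q d] //= /andP[/andP[q_gt0 _] _] ->.
  by apply/mapP => -[e _ [q0 _]]; rewrite q0 in q_gt0.
rewrite map_inj_in_uniq ?filter_uniq // => c d.
by rewrite !mem_filter; case: c => // p c; case: d => // q d _ _ [-> ->].
Qed.

Definition set_of_comp (gamma : seq nat) : seq nat :=
  [seq sumn (take j gamma) | j <- iota 1 (size gamma).-1].

(* For n = 0 the differences (n) must be replaced by the empty composition. *)
Definition comp_of_set (n : nat) (I : seq nat) : seq nat :=
  if n is 0 then [::] else pairmap (fun a b => b - a) 0 (rcons I n).

(* A formal power series with integer coefficients in the variables indexed by
   nat, where k : nat stands for x_{k+1}, is the function mapping a monomial, i.e.
   a multiset of indices, to its coefficient. *)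
Definition series : Type := {mset nat}%mset -> int.

(* The coefficient of the monomial A in F_gamma is the number of admissible
   sequences (i_1, ..., i_n) with x_{i_1} ... x_{i_n} = A, i.e. of admissible
   rearrangements of the elements of A. *)
Definition F_index (gamma s : seq nat) : bool :=
  [&& size s == sumn gamma, sorted leq s &
      all (fun j => nth 0 s j.-1 < nth 0 s j) (set_of_comp gamma)].

Definition F (gamma : seq nat) : series := fun A =>
  Posz (count (F_index gamma) (permutations (enum_mset A))).

Definition K (gamma : seq nat) : series := fun A =>
  let I := set_of_comp gamma in
  (2 ^+ (size I).+1 *
   \sum_(beta <- compositions (sumn gamma) |
         all (fun i => (i \in set_of_comp beta)
                         (+) (i \in map succn (set_of_comp beta))) I)
      F beta A)%R.

(* Boxes are pairs (column, row). *)
Definition diagram (alpha : seq nat) : seq (nat * nat) :=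
  [seq (c, r) | r <- iota 0 (size alpha), c <- iota 0 (nth 0 alpha r)].

(* A filling of D(alpha) is the sequence of its rows, from bottom to top. *)
Definition fillings (alpha : seq nat) : seq (seq (seq nat)) :=
  [seq reshape alpha w | w <- permutations (iota 1 (sumn alpha))].

Lemma mem_fillings alpha (T : seq (seq nat)) :
  (T \in fillings alpha) =
  (shape T == alpha) && perm_eq (flatten T) (iota 1 (sumn alpha)).
Proof.
apply/mapP/andP => [[w] | [/eqP <- T_perm]].
  rewrite mem_permutations => w_perm ->.
  have size_w : size w = sumn alpha by rewrite (perm_size w_perm) size_iota.
  by rewrite reshapeKl ?size_w // reshapeKr ?size_w // eqxx.
by exists (flatten T); rewrite ?mem_permutations // flattenK.
Qed.

Lemma fillings_uniq alpha : uniq (fillings alpha).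
Proof.
rewrite map_inj_in_uniq ?permutations_uniq // => v w.
rewrite !mem_permutations => /perm_size; rewrite size_iota => size_v.
move/perm_size; rewrite size_iota => size_w /(congr1 flatten).
by rewrite !reshapeKr ?size_v ?size_w.
Qed.

Definition entry (T : seq (seq nat)) (b : nat * nat) : nat :=
  nth 0 (nth [::] T b.2) b.1.

Definition increasing (T : seq (seq nat)) : bool :=
  all (sorted ltn) T && sorted ltn [seq head 0 row | row <- T].

(* Both lists of boxes are duplicate-free, so perm_eq is equality of sets. *)
Definition peak_tableau_condition (alpha : seq nat) (T : seq (seq nat)) : bool :=
  all (fun k =>
         has (fun beta => peak_composition beta &&
                perm_eq (diagram beta) [seq b <- diagram alpha | entry T b <= k])
             (compositions k))
      (iota 1 (sumn alpha)).

Definition SPIT (alpha : seq nat) : seq (seq (seq nat)) :=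
  [seq T <- fillings alpha | increasing T && peak_tableau_condition alpha T].

Definition SYCT_triple_rule (alpha : seq nat) (T : seq (seq nat)) : bool :=
  let D := diagram alpha in
  all (fun b => let: (k, j) := b in
         all (fun i =>
                ((k.+1, i) \in D) && (entry T (k, j) <= entry T (k.+1, i)) ==>
                ((k.+1, j) \in D) && (entry T (k.+1, j) < entry T (k.+1, i)))
             (iota 0 j))
      D.

Definition SYCT (alpha : seq nat) : seq (seq (seq nat)) :=
  [seq T <- fillings alpha | increasing T && SYCT_triple_rule alpha T].

Definition SPYCT (alpha : seq nat) : seq (seq (seq nat)) :=
  [seq T <- SYCT alpha | peak_tableau_condition alpha T].

Definition column (T : seq (seq nat)) (c : nat) : seq nat :=
  [seq nth 0 row c | row <- T & c < size row].

Definition num_columns (T : seq (seq nat)) : nat := \max_(row <- T) size row.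

Definition w_c (T : seq (seq nat)) : seq nat :=
  flatten [seq column T c | c <- iota 0 (num_columns T)].

Definition w_Y (T : seq (seq nat)) : seq nat :=
  rev (column T 0) ++ flatten [seq column T c | c <- iota 1 (num_columns T).-1].

Definition Des (sigma : seq nat) : seq nat :=
  [seq i <- iota 1 (size sigma).-1 | index i.+1 sigma < index i sigma].

Definition Peak (X : seq nat) : seq nat :=
  [seq i <- X | (1 < i) && (i.-1 \notin X)].

Definition quasisymmetric_Schur_Q (alpha : seq nat) : series := fun A =>
  (\sum_(T <- SPIT alpha) K (comp_of_set (sumn alpha) (Peak (Des (w_c T)))) A)%R.

Definition peak_Young_quasisymmetric_Schur (alpha : seq nat) : series := fun A =>
  (\sum_(T <- SPYCT alpha) K (comp_of_set (sumn alpha) (Peak (Des (w_Y T)))) A)%R.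

(* s_{i+1} . alpha, as parts are indexed from 0; used for i.+1 < size alpha. *)
Definition swap_parts (i : nat) (alpha : seq nat) : seq nat :=
  set_nth 0 (set_nth 0 alpha i (nth 0 alpha i.+1)) i.+1 (nth 0 alpha i).

Definition twos_then_part (alpha : seq nat) : Prop :=
  exists m k : nat, 2 <= k /\
    (alpha = nseq m 2 ++ [:: k] \/ alpha = nseq m 2 ++ [:: k; 1]).

(* Main.v *)
(** Write T(c,r) for the entry in column c and row r, counted from 0. For a peak
    composition, a filling with increasing rows and increasing first column
    satisfies the peak-tableau condition iff T(1,r) < T(0,r+1) for all r. Hence
    T(0,r) < T(1,r) < T(0,r+1), so column 0 contains no two consecutive integers,
    and reversing it does not change the descents: both readings have the same
    descent set.

    If row i is the only row with more than two boxes, the triple rule reduces to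
    the single inequality T(2,i) < T(1,i+1) (when both boxes exist). The tableaux
    violating it are turned into the elements of SPIT(s_i alpha) by moving the
    boxes of row i beyond the second column to row i+1; this changes neither the
    columns nor the column reading word. *)

Require Import Defs.
From mathcomp Require Import all_boot all_order all_algebra finmap multiset.

Set Implicit Arguments.
Unset Strict Implicit.
Unset Printing Implicit Defensive.

Import GRing.Theory.
Local Open Scope nat_scope.

(** * Diagrams, peak compositions and descents of words *)

Lemma lt_nth_size (a : seq nat) c r : c < nth 0 a r -> r < size a.
Proof. by apply: contraTltn => /(nth_default 0) ->. Qed.

Lemma mem_diagram (a : seq nat) c r : ((c, r) \in diagram a) = (c < nth 0 a r).
Proof.
apply/allpairsPdep/idP => [[r' [c' [_ + [-> ->]]]]|c_lt].
  by rewrite mem_iota add0n.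
by exists r, c; rewrite !mem_iota !add0n (lt_nth_size c_lt).
Qed.

Lemma diagram_uniq (a : seq nat) : uniq (diagram a).
Proof.
apply: allpairs_uniq_dep => [|r _|]; rewrite ?iota_uniq //.
by move=> [r c] [r' c'] _ _ /= [-> ->].
Qed.

Lemma peak_composition_rcons s p :
  peak_composition (rcons s p) = all (ltn 1) s && (0 < p).
Proof.
rewrite /peak_composition size_rcons /= -{2}cats1 take_size_cat // all_rcons.
rewrite -andbA andbC; congr (_ && _); apply: andb_idl.
by apply: sub_all => i /ltnW.
Qed.

Lemma peak_compositionP (a : seq nat) :
  reflect ((forall r, r < size a -> 0 < nth 0 a r) /\
           (forall r, r.+1 < size a -> 1 < nth 0 a r))
          (peak_composition a).
Proof.
case/lastP: a => [|s p]; first by left.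
rewrite peak_composition_rcons size_rcons; apply: (iffP andP).
  case=> /(all_nthP 0) s_gt1 p_gt0; split=> r; rewrite nth_rcons ltnS.
    rewrite leq_eqVlt => /predU1P[->|r_s]; first by rewrite ltnn eqxx.
    by rewrite r_s; apply/ltnW/s_gt1.
  by move=> r_s; rewrite r_s; apply: s_gt1.
case=> pos gt1; split.
  by apply/(all_nthP 0) => r r_s; move: (gt1 r); rewrite nth_rcons ltnS r_s; apply.
by move: (pos (size s)); rewrite nth_rcons ltnn eqxx; apply.
Qed.

(** The entries at most [k] form a prefix of [s], whose length is the count. *)
Lemma count_leq_sorted (s : seq nat) c k : sorted ltn s ->
  (c < count (geq k) s) = (c < size s) && (nth 0 s c <= k).
Proof.
elim: s c => [|x s IHs] c //= x_s.
have s_sorted := path_sorted x_s.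
case: (leqP x k) => x_k.
  by case: c => [|c]; rewrite /= ?x_k // add1n ltnS IHs.
have all_gt : all (ltn k) (x :: s).
  rewrite /= x_k; apply: sub_all (order_path_min ltn_trans x_s) => y.
  exact: ltn_trans.
rewrite add0n (@eq_in_count _ _ pred0) ?count_pred0.
  apply/esym/negbTE; rewrite negb_and orbC.
  case: (ltnP c) => [c_lt|_]; rewrite ?orbT // orbF -ltnNge.
  exact: (all_nthP 0 all_gt).
by move=> y y_s /=; apply/negbTE; rewrite -ltnNge; apply: (allP all_gt);
  rewrite inE y_s orbT.
Qed.

(** Reversal of [s] alters the relative order only of letters both in [s], and [x], [x.+1] are never
    both there. If just one of them is in [s], it precedes the other in both words. *)
Lemma Des_rev_cat (s t : seq nat) :
  {in s, forall x, x.+1 \notin s} -> Des (rev s ++ t) = Des (s ++ t).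
Proof.
move=> s_sep; rewrite /Des !size_cat size_rev; apply: eq_filter => x.
rewrite !index_cat !mem_rev size_rev.
have [index_s index_rev] : index x s <= size s /\ index x (rev s) <= size s.
  by rewrite -{2}(size_rev s) !index_size.
case: (boolP (x \in s)) => [x_s|xNs].
  by rewrite (negbTE (s_sep x x_s)) !ltnNge !(leq_trans _ (leq_addr _ _)).
case: ifP => // x1_s; rewrite !ltn_addr ?index_mem //.
by rewrite -(size_rev s) index_mem mem_rev.
Qed.

(** In a peak composition only the last row may lack a second box, and that row is never the first
    argument in [sorted row_step T], so the default 0 is not reached. *)
Definition row_step (row row' : seq nat) : bool := nth 0 row 1 < head 0 row'.

(** * The peak-tableau condition as inequalities between adjacent rows *)

Section Fillings.

Variables (alpha : seq nat) (T : seq (seq nat)).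
Hypothesis (alpha_peak : peak_composition alpha) (T_fill : T \in fillings alpha).
Hypothesis T_incr : increasing T.

Let shapeT : shape T = alpha.
Proof. by move: T_fill; rewrite mem_fillings => /andP[/eqP]. Qed.

Let permT : perm_eq (flatten T) (iota 1 (sumn alpha)).
Proof. by move: T_fill; rewrite mem_fillings => /andP[]. Qed.

Let sizeT : size T = size alpha.
Proof. by rewrite -shapeT size_map. Qed.

Lemma size_row r : size (nth [::] T r) = nth 0 alpha r.
Proof.
rewrite -shapeT; case: (ltnP r (size T)) => r_T; first by rewrite (nth_map [::]).
by rewrite !nth_default ?size_map.
Qed.

Lemma row_sorted r : sorted ltn (nth [::] T r).
Proof.
case/andP: T_incr => /(all_nthP [::]) rows _.
by case: (ltnP r (size T)) => r_T; [apply: rows | rewrite nth_default].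
Qed.

Lemma entry_row r c c' : c < c' < nth 0 alpha r -> entry T (c, r) < entry T (c', r).
Proof.
case/andP=> cc' c'_lt; apply: (sorted_ltn_nth ltn_trans) => //=.
- exact: row_sorted.
- by rewrite inE size_row (ltn_trans cc').
- by rewrite inE size_row.
Qed.

Lemma entry_column0 r r' : r < r' < size alpha -> entry T (0, r) < entry T (0, r').
Proof.
case/andP: T_incr => _ heads /andP[rr' r'_lt].
have r_lt := ltn_trans rr' r'_lt.
have: nth 0 [seq head 0 row | row <- T] r < nth 0 [seq head 0 row | row <- T] r'.
  by apply: (sorted_ltn_nth ltn_trans); rewrite ?inE ?size_map ?sizeT.
by rewrite !(nth_map [::]) ?sizeT // /entry /= !nth0.
Qed.

Lemma entry_flatten c r : c < nth 0 alpha r -> entry T (c, r) \in flatten T.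
Proof.
move=> c_lt; apply/flattenP; exists (nth [::] T r).
  by rewrite mem_nth // sizeT (lt_nth_size c_lt).
by rewrite /entry mem_nth //= size_row.
Qed.

Lemma flatten_index_lt c r : c < nth 0 alpha r ->
  flatten_index (shape T) r c < size (flatten T).
Proof. by rewrite -shapeT size_flatten => ?; apply: flatten_indexP. Qed.

(** Forward: for k = T(0,r+1) the boxes with entries at most k include row r+1, so row r has two of
    them and T(1,r) <= k. Backward: these boxes form a prefix of each row, and the row steps give
    every nonempty prefix but the last at least two boxes. *)
Lemma peak_tableau_conditionE :
  peak_tableau_condition alpha T = sorted row_step T.
Proof.
have [pos gt1] := peak_compositionP _ alpha_peak.
apply/allP/(sortedP [::]) => [cond r|step k k_iota].
  rewrite /row_step sizeT => r1_lt.
  have a_in : 0 < nth 0 alpha r.+1 by apply: pos.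
  have b_in : 1 < nth 0 alpha r by apply: gt1.
  have k_in : entry T (0, r.+1) \in iota 1 (sumn alpha).
    by rewrite -(perm_mem permT) entry_flatten.
  case/hasP: (cond _ k_in) => beta _ /andP[/peak_compositionP[_ beta_gt1] D_beta].
  have : (0, r.+1) \in diagram beta.
    by rewrite (perm_mem D_beta) mem_filter leqnn mem_diagram.
  rewrite mem_diagram => a_beta.
  have /beta_gt1 := lt_nth_size a_beta.
  rewrite -mem_diagram (perm_mem D_beta) mem_filter => /andP[le_ba _].
  rewrite -nth0 ltn_neqAle; apply/andP; split=> //; apply/negP => /eqP eq_ba.
  (* Equal entries would occupy the same position of [flatten T]; reading the row index back from
     that position gives r = r+1. *)
  have : uniq (flatten T) by rewrite (perm_uniq permT) iota_uniq.
  move/uniqP => /(_ 0 (flatten_index (shape T) r 1) (flatten_index (shape T) r.+1 0)).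
  rewrite !inE !flatten_index_lt // !nth_flatten !flatten_indexKl ?shapeT //.
  rewrite !flatten_indexKr ?shapeT // => /(_ isT isT eq_ba).
  move/(congr1 (reshape_index alpha)).
  rewrite !flatten_indexKl // => /eqP; by rewrite -[r in r == _]addn0 -addn1 eqn_add2l.
(* [g r] is the length of the prefix of row [r] with entries at most [k], and [m] below is the first
   row where it is empty. As the first column increases, it stays empty from there on, so the peak
   composition sought is [mkseq g m]. *)
pose g r := count (geq k) (nth [::] T r).
have gE c r : (c < g r) = (c < nth 0 alpha r) && (entry T (c, r) <= k).
  by rewrite /g count_leq_sorted ?size_row ?row_sorted.
pose m := find (fun row => count (geq k) row == 0) T.
have m_le : m <= size T by apply: find_size.
have g_gt0 r : r < m -> 0 < g r.
  by move=> r_m; rewrite lt0n; apply: (negbT (before_find [::] r_m)).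
have g_eq0 r : m <= r -> g r = 0.
  case: (ltnP r (size T)) => [r_T m_r|r_T _]; last by rewrite /g nth_default.
  have m_T := leq_ltn_trans m_r r_T.
  have /eqP gm0 : g m == 0.
    by rewrite /g (@nth_find _ [::] (fun row => count (geq k) row == 0)) ?has_find.
  apply/eqP; rewrite -leqn0 leqNgt gE; apply/negP => /andP[_ ar_k].
  suff : 0 < g m by rewrite gm0.
  rewrite gE pos -?sizeT //=; apply: leq_trans ar_k.
  move: m_r; rewrite leq_eqVlt => /predU1P[->//|m_r].
  by rewrite ltnW // entry_column0 // m_r -sizeT.
pose beta := mkseq g m.
have nth_beta r : nth 0 beta r = g r.
  case: (ltnP r m) => r_m; first by rewrite nth_mkseq.
  by rewrite nth_default ?size_mkseq // g_eq0.
(* The entries at most [k] of a permutation of 1, ..., n are counted in two ways. *)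
have sum_beta : sumn beta = k.
  have -> : k = count (geq k) (flatten T).
    move: k_iota; rewrite mem_iota add1n ltnS => /andP[_ k_n].
    rewrite (permP permT) -(subnKC k_n) iotaD count_cat (@eq_in_count _ _ predT).
      rewrite count_predT size_iota (@eq_in_count _ _ pred0) ?count_pred0 ?addn0 //.
      by move=> i; rewrite mem_iota add1n => /andP[? _]; apply/negbTE; rewrite /= -ltnNge.
    by move=> i; rewrite mem_iota add1n ltnS => /andP[_ ?].
  rewrite count_flatten -[in RHS](mkseq_nth [::] T) -map_comp -(subnKC m_le).
  rewrite iotaD map_cat sumn_cat (_ : map _ (iota (0 + m) _) = nseq (size T - m) 0).
    by rewrite sumn_nseq addn0.
  apply: (@eq_from_nth _ 0) => [|r]; rewrite size_map size_iota ?size_nseq // => r_lt.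
  by rewrite nth_nseq r_lt (nth_map 0) ?size_iota // nth_iota //; apply/g_eq0/leq_addr.
apply/hasP; exists beta.
  rewrite mem_compositions /composition sum_beta eqxx andbT.
  by apply/allP => _ /mapP[r + ->]; rewrite mem_iota => /andP[_ /g_gt0].
apply/andP; split.
  apply/peak_compositionP; split=> r; rewrite size_mkseq nth_beta; first exact: g_gt0.
  (* Here T(1,r) < T(0,r+1) <= k, so the prefix of row [r] contains a second box. *)
  move=> r1_m; have r1_T : r.+1 < size T by apply: leq_trans m_le.
  rewrite gE gt1 -?sizeT //=; move: (g_gt0 _ r1_m); rewrite gE => /andP[_].
  by apply: leq_trans; rewrite ltnW //; move: (step _ r1_T); rewrite /row_step -nth0.
apply: uniq_perm; rewrite ?filter_uniq ?diagram_uniq // => -[c r].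
by rewrite mem_filter !mem_diagram nth_beta gE andbC.
Qed.

(** * Triple rule and descents under the row steps *)

Hypothesis T_step : sorted row_step T.

Lemma entry_step r r' : r < r' < size alpha -> entry T (1, r) < entry T (0, r').
Proof.
case/andP=> rr' r'_lt; have r1_lt := leq_ltn_trans rr' r'_lt.
have /sortedP-/(_ [::] r) := T_step; rewrite sizeT r1_lt /row_step -nth0 => /(_ isT).
move=> /leq_trans; apply; move: rr'; rewrite leq_eqVlt => /predU1P[->//|r1_r'].
by apply/ltnW/entry_column0; rewrite r1_r'.
Qed.

Lemma entry_column1 r r' : r < r' -> 1 < nth 0 alpha r' ->
  entry T (1, r) < entry T (1, r').
Proof.
move=> rr' r'1; apply: (@ltn_trans (entry T (0, r'))).
  by rewrite entry_step // rr' (lt_nth_size r'1).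
exact: entry_row.
Qed.

(** A premise T(k,j) <= T(k+1,r) with r < j fails for k = 0 by the row steps, and for k >= 2 both
    rows would be row [i]. For k = 1 the lower row is row [i], and the case j = i+1 implies the
    others because column 1 increases. *)
Lemma SYCT_triple_ruleE i :
    (forall r, r != i -> nth 0 alpha r <= 2) ->
  SYCT_triple_rule alpha T =
  (1 < nth 0 alpha i.+1) && (2 < nth 0 alpha i)
    ==> (entry T (2, i) < entry T (1, i.+1)).
Proof.
have [_ gt1] := peak_compositionP _ alpha_peak => le2.
have row_i r c : 2 <= c -> c < nth 0 alpha r -> r = i.
  move=> c2 c_lt; apply/eqP; apply: contraLR c_lt => /le2 r2.
  by rewrite -leqNgt (leq_trans r2).
apply/allP/implyP => [rule /andP[b_in c_in]|cond [k j]].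
  (* The box (2,i+1) demanded by the rule does not exist, so its premise must fail. *)
  have := rule (1, i.+1); rewrite mem_diagram => /(_ b_in) /allP /(_ i).
  rewrite mem_iota add0n ltnS leqnn => /(_ isT); rewrite !mem_diagram c_in /=.
  have -> : (2 < nth 0 alpha i.+1) = false.
    by apply/negbTE; rewrite -leqNgt le2 // neq_ltn ltnSn orbT.
  by rewrite implybF -ltnNge.
rewrite mem_diagram => kj_in; apply/allP => r; rewrite mem_iota add0n => /= r_j.
rewrite !mem_diagram; apply/implyP => /andP[kr_in le_jr]; exfalso.
move: le_jr; apply/negP; rewrite -ltnNge.
have j_lt := lt_nth_size kj_in.
case: k => [|[|k]] in kj_in kr_in *.
- by rewrite entry_step // r_j.
- have r_i : r = i by apply: row_i kr_in.
  (* Either j = i+1, which has a box in column 1, or row i+1 is not the last row. *)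
  have b_in : 1 < nth 0 alpha i.+1.
    move: r_j; rewrite r_i leq_eqVlt => /predU1P[->//|i1_j].
    exact/gt1/leq_ltn_trans/j_lt.
  rewrite r_i in r_j kr_in *; apply: leq_trans (cond _) _; first by rewrite b_in.
  move: r_j; rewrite leq_eqVlt => /predU1P[->//|i1_j].
  exact/ltnW/entry_column1.
- move: r_j; rewrite (row_i _ _ _ kj_in) // (row_i _ _ _ kr_in) //.
  by rewrite ltnn.
Qed.

Lemma column0_nonconsecutive x : x \in column T 0 -> x.+1 \notin column T 0.
Proof.
have [_ gt1] := peak_compositionP _ alpha_peak.
have col0 y : y \in column T 0 -> exists2 r, r < size alpha & y = entry T (0, r).
  case/mapP=> row; rewrite mem_filter => /andP[_ /(nthP [::])[r r_T <-]] ->.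
  by exists r; rewrite -?sizeT.
move=> /col0[r r_lt x_r]; apply/negP => /col0[r' r'_lt x_r'].
case: (ltngtP r r') => [rr'|r'r|rr']; last by move: x_r'; rewrite -rr' -x_r => /esym/n_Sn.
- have : entry T (0, r) < entry T (1, r).
    by apply: entry_row; rewrite gt1 // (leq_ltn_trans rr').
  have := @entry_step r r'; rewrite rr' r'_lt => /(_ isT).
  by rewrite -x_r -x_r' ltnS leqNgt => /negP.
- have := @entry_column0 r' r; rewrite r'r r_lt -x_r -x_r' ltnNge ltnW //.
  by move=> /(_ isT).
Qed.

Lemma Des_w_Y : Des (w_Y T) = Des (w_c T).
Proof.
rewrite /w_c /w_Y.
(* Without columns, [w_c] does not list column 0 whereas [w_Y] does; that column is then empty. *)
have colE : column T 0 = [::] \/ 0 < num_columns T.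
  have [nc0|nc_gt0] := posnP (num_columns T); [left|by right].
  have : num_columns T <= 0 by rewrite nc0.
  move/bigmax_leqP_seq => sizes; rewrite /column.
  rewrite (@eq_in_filter _ _ pred0) ?filter_pred0 // => row row_T.
  by apply/negbTE; rewrite -leqNgt sizes.
case: colE => [col0|]; last case: num_columns => //= m _.
  by rewrite col0; case: num_columns => //= m; rewrite col0.
exact/Des_rev_cat/column0_nonconsecutive.
Qed.

End Fillings.

(** * The peak Young function as a sum over [SPIT] *)

Lemma mem_SPIT (alpha : seq nat) T : peak_composition alpha ->
  (T \in SPIT alpha) = [&& T \in fillings alpha, increasing T & sorted row_step T].
Proof.
move=> alpha_peak; rewrite mem_filter [LHS]andbC; apply: andb_id2l => T_fill.
by apply: andb_id2l => T_incr; rewrite peak_tableau_conditionE.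
Qed.

Lemma SPYCT_SPIT alpha :
  SPYCT alpha = [seq T <- SPIT alpha | SYCT_triple_rule alpha T].
Proof.
rewrite /SPYCT /SYCT /SPIT -!filter_predI; apply: eq_filter => T /=.
by rewrite andbC -andbA andbCA andbA.
Qed.

Lemma peak_Young_sum_SPIT alpha A i : peak_composition alpha ->
    (forall r, r != i -> nth 0 alpha r <= 2) ->
  peak_Young_quasisymmetric_Schur alpha A =
  (\sum_(T <- SPIT alpha | ((1 < nth 0 alpha i.+1) && (2 < nth 0 alpha i)
                              ==> (entry T (2, i) < entry T (1, i.+1)))%N)
     K (comp_of_set (sumn alpha) (Peak (Des (w_c T)))) A)%R.
Proof.
move=> alpha_peak le2; rewrite /peak_Young_quasisymmetric_Schur SPYCT_SPIT big_filter.
rewrite big_seq_cond [RHS]big_seq_cond; apply: eq_big => [T|T /andP[]].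
  apply: andb_id2l; rewrite mem_SPIT // => /and3P[T_fill T_incr T_step].
  exact: SYCT_triple_ruleE.
by rewrite mem_SPIT // => /and3P[T_fill T_incr T_step] _; rewrite (@Des_w_Y alpha).
Qed.

(** * Moving the boxes of the wide row to the next row *)

Definition move_tail (i : nat) (T : seq (seq nat)) : seq (seq nat) :=
  let row := nth [::] T i in
  take i T ++ take 2 row :: (nth [::] T i.+1 ++ drop 2 row) :: drop i.+2 T.

(** Tableaux are split explicitly here and below, the wide row having index [size U]. When [row] has
    two entries, those of [C] keep their columns. *)
Lemma move_tail_cat (U V : seq (seq nat)) x y C row :
  move_tail (size U) (U ++ (x :: y :: C) :: row :: V) =
  U ++ [:: x; y] :: (row ++ C) :: V.
Proof.
rewrite /move_tail take_size_cat // !nth_cat ltnn ltnNge leqnSn /= subnn subSnn.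
rewrite -(addn2 (size U)) drop_cat ltnNge leq_addr addKn /=.
by rewrite take0 !drop0.
Qed.

Lemma swap_parts_cat u v p q :
  swap_parts (size u) (u ++ p :: q :: v) = u ++ q :: p :: v.
Proof. by elim: u => //= r u IHu; rewrite -[in RHS]IHu. Qed.

Lemma shape_catP (T : seq (seq nat)) u v : shape T = u ++ v ->
  exists U V, [/\ T = U ++ V, shape U = u & shape V = v].
Proof.
move=> shapeT; exists (take (size u) T), (drop (size u) T).
rewrite cat_take_drop /shape map_take map_drop -[map size T]/(shape T) shapeT.
by rewrite take_size_cat ?drop_size_cat.
Qed.

Section MoveTail.

Variables (u v : seq nat) (k : nat).
Let alpha := u ++ k.+3 :: 2 :: v.
Let beta := u ++ 2 :: k.+3 :: v.
Hypothesis alpha_peak : peak_composition alpha.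

(** Both exchanged parts exceed 1, so either of them may stand before the other. *)
Lemma swap_peak : peak_composition beta.
Proof.
move: alpha_peak; rewrite /alpha /beta; case/lastP: v => [|v' p].
  rewrite -(cat_rcons k.+3 _ [:: 2]) -(cat_rcons 2 _ [:: k.+3]) !cats1.
  by rewrite !peak_composition_rcons !all_rcons.
by rewrite -!rcons_cons -!rcons_cat !peak_composition_rcons !all_cat /=.
Qed.

Lemma SPIT_wideP T : T \in SPIT alpha -> exists U V x y C z t,
  [/\ T = U ++ (x :: y :: C) :: [:: z; t] :: V, size U = size u & size C = k.+1].
Proof.
rewrite mem_filter => /andP[_]; rewrite mem_fillings => /andP[/eqP + _].
case/shape_catP=> U [W [-> /(congr1 size)]]; rewrite size_map => size_U.
case: W => [|[|x [|y C]] [|[|z [|t [|? ?]]] V]] // [size_C _].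
by exists U, V, x, y, C, z, t.
Qed.

(** Identifies the two entries compared by the reduced triple rule. *)
Lemma entries_wide U V x y C z t (T := U ++ (x :: y :: C) :: [:: z; t] :: V) :
  entry T (2, size U) = head 0 C /\ entry T (1, (size U).+1) = t.
Proof.
by rewrite /entry /= !nth_cat ltnn ltnNge leqnSn /= subnn subSnn /= nth0.
Qed.

Lemma move_tail_fillings U V x y C z t : size U = size u -> size C = k.+1 ->
  (U ++ [:: x; y] :: (z :: t :: C) :: V \in fillings beta) =
  (U ++ (x :: y :: C) :: [:: z; t] :: V \in fillings alpha).
Proof.
move=> size_U size_C; rewrite !mem_fillings; congr (_ && _).
  by rewrite /shape !map_cat /= !eqseq_cat ?size_map // !eqseq_cons size_C !eqxx.
rewrite !sumn_cat /= [2 + _]addnCA.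
apply: (elimT permPl); rewrite !flatten_cat perm_cat2l /=.
by rewrite !perm_cons (perm_catCA [:: z; t] C (flatten V)).
Qed.

(** [row_step] sees only the first two entries of a row, which stay in place. *)
Lemma move_tail_row_step U V x y C z t :
  sorted row_step (U ++ [:: x; y] :: (z :: t :: C) :: V) =
  sorted row_step (U ++ (x :: y :: C) :: [:: z; t] :: V).
Proof.
have tail_eq : path row_step (z :: t :: C) V = path row_step [:: z; t] V by case: V.
by case: U => [|row U]; rewrite /= ?cat_path /= tail_eq.
Qed.

(** Let c be the head of [C]. The left side needs t < c, the right side y < c and t <= c. They agree
    since c and t are distinct and y < z < t. *)
Lemma move_tail_SPIT U V x y C z t : size U = size u -> size C = k.+1 ->
  (U ++ [:: x; y] :: (z :: t :: C) :: V \in SPIT beta) =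
  (U ++ (x :: y :: C) :: [:: z; t] :: V \in SPIT alpha) && (t <= head 0 C).
Proof.
move=> size_U size_C; rewrite !mem_SPIT ?swap_peak // move_tail_row_step.
rewrite move_tail_fillings // -!andbA; apply: andb_id2l.
rewrite mem_fillings => /andP[_ /perm_uniq]; rewrite iota_uniq flatten_cat /=.
case: C size_C => // c C _; rewrite cat_uniq => /and3P[_ _] /= /and4P[_ _ + _].
rewrite mem_cat !inE !negb_or => /and4P[_ _ c_t _].
(* This is the row step between the two rows; if it fails, both sides are false. *)
have [y_z|] := boolP (y < z); last first.
  move=> /negbTE yNz; rewrite !(@andbC _ (sorted row_step _)) /=.
  have -> : sorted row_step (U ++ [:: x, y, c & C] :: [:: z; t] :: V) = false.
    by case: U {size_U} => [|row U]; rewrite /= ?cat_path /= /row_step /= yNz ?andbF.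
  by rewrite !andbF.
case: (sorted row_step _); last by rewrite !andbF.
rewrite /increasing !all_cat !map_cat /= !andbT.
case: (sorted ltn (_ ++ _)); rewrite ?andbF ?andbT //=.
case: (all _ U); case: (all _ V); rewrite ?andbF ?andbT //=.
case: (x < y); case: (path ltn c C); rewrite ?andbF ?andbT //=.
have [z_t|] := ltnP z t; rewrite ?andbF ?andbT //=.
have [t_c|c_le_t] := ltnP t c.
  by rewrite (ltn_trans y_z (ltn_trans z_t t_c)) ltnW.
have c_lt_t : c < t by rewrite ltn_neqAle c_t.
by rewrite [t <= c]leqNgt c_lt_t andbF.
Qed.

(** Beyond column 1 just one of the two adjacent rows can have boxes, so moving them from one to the
    other leaves every column unchanged as a word. *)
Lemma w_c_move_tail U V x y C z t :
  w_c (U ++ [:: x; y] :: (z :: t :: C) :: V) =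
  w_c (U ++ (x :: y :: C) :: [:: z; t] :: V).
Proof.
rewrite /w_c (_ : num_columns _ = num_columns (U ++ (x :: y :: C) :: [:: z; t] :: V)).
  congr flatten; apply: eq_map => -[|[|c]];
    by rewrite /column !filter_cat !map_cat //=; case: ifP.
rewrite /num_columns !big_cat !big_cons /=; congr maxn.
exact: maxnCA.
Qed.

(** Stated with [perm_eq] so that the sum over the swapped shape can be reindexed by the violating
    tableaux. *)
Lemma perm_move_tail :
  perm_eq [seq move_tail (size u) T
             | T <- SPIT alpha & entry T (1, (size u).+1) <= entry T (2, size u)]
          (SPIT beta).
Proof.
apply: uniq_perm.
- rewrite map_inj_in_uniq ?filter_uniq ?fillings_uniq // => T T'.
  rewrite mem_filter => /andP[_ /SPIT_wideP].
  case=> [U [V [x [y [C [z [t [-> size_U _]]]]]]]].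
  rewrite mem_filter => /andP[_ /SPIT_wideP].
  case=> [U' [V' [x' [y' [C' [z' [t' [-> size_U' _]]]]]]]].
  rewrite -{1}size_U -size_U' !move_tail_cat.
  by move/eqP; rewrite eqseq_cat ?size_U // => /andP[/eqP-> /eqP[-> -> -> -> -> ->]].
- by rewrite filter_uniq ?fillings_uniq.
move=> T; apply/mapP/idP => [[{}T + ->]|T_in].
  rewrite mem_filter => /andP[le_tc /[dup] T_in].
  case/SPIT_wideP=> [U [V [x [y [C [z [t]]]]]]] [T_eq size_U size_C].
  move: le_tc T_in; rewrite T_eq -size_U.
  have [-> ->] := entries_wide U V x y C z t => le_tc T_in.
  by rewrite move_tail_cat move_tail_SPIT ?T_in.
(* Surjectivity: the preimage is obtained by moving [C] back down. *)
have : exists U V x y C z t,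
    [/\ T = U ++ [:: x; y] :: (z :: t :: C) :: V, size U = size u & size C = k.+1].
  move: T_in; rewrite mem_filter => /andP[_]; rewrite mem_fillings => /andP[/eqP + _].
  case/shape_catP=> U [W [-> /(congr1 size)]]; rewrite size_map => size_U.
  case: W => [|[|x [|y [|? ?]]] [|[|z [|t C]] V]] // [size_C _].
  by exists U, V, x, y, C, z, t.
case=> [U [V [x [y [C [z [t]]]]]]] [T_eq size_U size_C].
exists (U ++ (x :: y :: C) :: [:: z; t] :: V); last by rewrite -size_U move_tail_cat.
move: T_in; rewrite T_eq move_tail_SPIT // => /andP[T_in le_tc].
rewrite mem_filter T_in -size_U.
by have [-> ->] := entries_wide U V x y C z t; rewrite le_tc.
Qed.

End MoveTail.

(** * Compositions with a single part above 2 *)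

Lemma le2_off_wide (u w : seq nat) p r : 2 < p ->
  count (fun q => 2 < q) (u ++ p :: w) <= 1 ->
  r != size u -> nth 0 (u ++ p :: w) r <= 2.
Proof.
move=> p_gt2; rewrite count_cat /= p_gt2 addnCA add1n ltnS leqn0 addn_eq0.
have count0 s : count (fun q => 2 < q) s == 0 -> ~~ has (fun q => 2 < q) s.
  by rewrite has_count lt0n => ->.
case/andP=> /count0/hasPn u_le2 /count0/hasPn w_le2; rewrite nth_cat neq_ltn.
case: ltnP => [r_u _|u_r /= ]; first by rewrite leqNgt u_le2 ?mem_nth.
rewrite -subn_gt0; case: (r - size u) => //= s _.
case: (ltnP s (size w)) => s_w; last by rewrite nth_default.
by rewrite leqNgt w_le2 ?mem_nth.
Qed.

(** Parts before the wide one are not last, hence equal to 2. The next part decides: if it is absent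
    or 1, the shape is one of the displayed forms, and otherwise it is 2. *)
Lemma twos_or_split (alpha : seq nat) i :
    peak_composition alpha -> count (fun p => 2 < p) alpha <= 1 ->
    2 < nth 0 alpha i ->
  twos_then_part alpha \/
  exists u v k, alpha = u ++ k.+3 :: 2 :: v /\ size u = i.
Proof.
move=> alpha_peak alpha_le1 i_gt2; have i_lt := lt_nth_size i_gt2.
have [pos gt1] := peak_compositionP _ alpha_peak.
have size_u : size (take i alpha) = i by rewrite size_takel // ltnW.
have alphaE := esym (cat_take_drop i alpha); rewrite (drop_nth 0) // in alphaE.
have le2 r : r != i -> nth 0 alpha r <= 2.
  have := @le2_off_wide (take i alpha) (drop i.+1 alpha) (nth 0 alpha i) r i_gt2.
  by rewrite -alphaE size_u; apply.
have twos : take i alpha = nseq i 2.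
  apply: (@eq_from_nth _ 0); rewrite ?size_nseq // size_u => r r_i.
  rewrite nth_take // nth_nseq r_i; apply/eqP; rewrite eqn_leq le2 ?gt1 ?neq_ltn ?r_i //.
  exact: leq_ltn_trans i_lt.
have nth_drop1 : nth 0 alpha i.+1 = head 0 (drop i.+1 alpha).
  by rewrite -nth0 nth_drop addn0.
have size_drop1 : size alpha = i.+1 + size (drop i.+1 alpha) by rewrite size_drop subnKC.
case def_w: (drop i.+1 alpha) => [|q v] in alphaE nth_drop1 size_drop1 *.
  left; exists i, (nth 0 alpha i); split; first exact: ltnW.
  by left; rewrite -twos.
have q_gt0 : 0 < q by rewrite -[q]nth_drop1 pos // size_drop1 /= addnS ltnS leq_addr.
have q_le2 : q <= 2 by rewrite -[q]nth_drop1 le2 // neq_ltn ltnSn orbT.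
have [q1|q_neq1] := eqVneq q 1.
  left; exists i, (nth 0 alpha i); split; first exact: ltnW.
  (* A part 1 can only be the last one, so [v] is empty. *)
  right; rewrite -twos -q1; case: v => // q' v in def_w alphaE size_drop1 nth_drop1 *.
  have := gt1 i.+1; rewrite size_drop1 /= !addnS !ltnS leq_addr nth_drop1 /= q1.
  by move=> /(_ isT).
right; exists (take i alpha), v, (nth 0 alpha i - 3); split=> //.
rewrite {1}alphaE; congr (_ ++ _ :: _ :: _); first by rewrite -addn3 subnK.
by case: q q_gt0 q_le2 q_neq1 {nth_drop1 size_drop1 alphaE def_w} => [|[|[|]]].
Qed.

(** * Comparison of the two functions *)

Theorem proposition4p12 (alpha : seq nat) :
  peak_composition alpha ->
  (count (fun p => 2 < p)%N alpha <= 1)%N ->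
  (twos_then_part alpha ->
     peak_Young_quasisymmetric_Schur alpha =1 quasisymmetric_Schur_Q alpha) /\
  (~ twos_then_part alpha ->
     forall i : nat, (2 < nth 0%N alpha i)%N ->
       peak_Young_quasisymmetric_Schur alpha =1
       (fun A => quasisymmetric_Schur_Q alpha A
                 - quasisymmetric_Schur_Q (swap_parts i alpha) A)%R).
Proof.
move=> alpha_peak alpha_le1; split=> [[m [k [_ alphaE]]] A|not_twos i i_gt2 A].
  have nth_lt r : r < m -> nth 0 alpha r = 2.
    by move=> r_m; case: alphaE => ->; rewrite nth_cat size_nseq r_m nth_nseq r_m.
  have nth_gt r : m < r -> nth 0 alpha r <= 1.
    move=> m_r; case: alphaE => ->; rewrite nth_cat size_nseq (leq_gtF (ltnW m_r));
      by move: m_r; rewrite -subn_gt0; case: (r - m) => [|[|s]] //= _; rewrite nth_nil.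
  (* Row [m] holds the part [k], and the row above has at most one box, so the reduced triple rule
     is vacuous. *)
  rewrite (@peak_Young_sum_SPIT _ _ m) // => [|r].
    by apply: eq_bigl => T; rewrite [1 < nth _ _ _]ltnNge nth_gt.
  by rewrite neq_ltn => /orP[/nth_lt->|/nth_gt/leqW].
case: (twos_or_split alpha_peak alpha_le1 i_gt2) => // -[u [v [k [alphaE size_u]]]].
move: alpha_peak alpha_le1; rewrite -size_u alphaE => {}alpha_peak alpha_le1.
rewrite (@peak_Young_sum_SPIT _ _ (size u)) // => [|r]; last exact: le2_off_wide.
rewrite swap_parts_cat /quasisymmetric_Schur_Q.
(* The subtracted sum is moved to the other side; the sum over [SPIT alpha] then splits into
   tableaux obeying and violating the inequality. *)
apply/eqP; rewrite eq_sym subr_eq; apply/eqP.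
rewrite -(perm_big _ (perm_move_tail alpha_peak)) big_map big_filter.
rewrite (bigID (fun T => entry T (2, size u) < entry T (1, (size u).+1))) /=.
congr (_ + _)%R.
  by apply: eq_bigl => T; rewrite !nth_cat ltnn (leq_gtF (leqnSn _)) subnn subSnn.
rewrite big_seq_cond [RHS]big_seq_cond.
apply: eq_big => [T|T /andP[/SPIT_wideP]]; first by rewrite -leqNgt.
case=> [U [V [x [y [C [z [t [-> <- _]]]]]]]] _.
rewrite move_tail_cat w_c_move_tail; congr (K (comp_of_set _ _) A).
by rewrite !sumn_cat /= [k.+3 + _]addnCA.
Qed.
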